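(* Let $\Bbbk$ be an algebraically closed field and let $A$ be a finite-dimensional basic $\Bbbk$-algebra with a fixed set of orthogonal primitive idempotents $\{e_\lambda\}_{\lambda\in\Lambda}$ such that $\sum_{\lambda\in\Lambda}e_\lambda=1$. Let $\mathcal{L}$ be the set of linear orders on $\Lambda$ produced by the algorithm described in the context. Then $A$ is standardly stratified for every linear order $\preccurlyeq\,\in\mathcal{L}$.
   Context: All modules are finitely generated left modules; the zero module is regarded as projective. $P_\lambda=Ae_\lambda$, $S_\lambda=P_\lambda/\mathrm{rad}\,P_\lambda$. For a module $M$, $\mathrm{tr}_{P_\lambda}(M)$ is the sum of the images of all homomorphisms $P_\lambda\to M$. Stratification. For a linear order $\preccurlyeq$ on $\Lambda$, the standard module ${}_{\preccurlyeq}\Delta_\lambda$ is the largest quotient of $P_\lambda$ all of whose composition factors $S_\mu$ satisfy $\mu\preccurlyeq\lambda$. $A$ is standardly stratified for $\preccurlyeq$ if for every $\lambda\in\Lambda$ the kernel of $P_\lambda\to{}_{\preccurlyeq}\Delta_\lambda$ has a filtration with factors ${}_{\preccurlyeq}\Delta_\mu$ with $\mu\succ\lambda$. The algorithm. (1) Define $O_1=\{\lambda\in\Lambda\mid\forall\mu\in\Lambda,\ \mathrm{tr}_{P_\lambda}(P_\mu)\cong P_\lambda^{m_\mu}\text{ for some }m_\mu\geqslant0\}$. If $O_1=\emptyset$, the algorithm ends. (2) Otherwise define a partial order $\leqslant'$ on $O_1$ by $\lambda\leqslant'\mu$ if and only if $\mathrm{tr}_{P_\mu}(P_\lambda)\neq0$.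 (3) Take an element $s_1\in O_1$ that is maximal with respect to $\leqslant'$, and let $\bar{A}=A/Ae_{s_1}A$. (4) Repeat these steps for $\bar{A}$ (with index set $\Lambda\setminus\{s_1\}$ and the images of the remaining idempotents) recursively until the algorithm ends. This yields a chain $s_1,s_2,\ldots,s_t$, and one sets $s_1\succ s_2\succ\cdots\succ s_t$. Let $\tilde{\mathcal{L}}$ be the set of all linear orders obtained in this way (over all possible choices of maximal elements in step (3)), and let $\mathcal{L}\subseteq\tilde{\mathcal{L}}$ be the subset of those of length $t=|\Lambda|$, i.e. those which are linear orders on all of $\Lambda$. *)

(* Defs.v *)
From HB Require Import structures.
From mathcomp Require Import all_boot all_algebra all_field.
From mathcomp Require Import generic_quotient ring_quotient boolp.

Set Implicit Arguments.
Unset Strict Implicit.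
Unset Printing Implicit Defensive.

Import GRing.Theory.
Local Open Scope ring_scope.
Local Open Scope quotient_scope.

(* A submodule of M is a [N : submodClosed M]; all predicates that are only   *)
(* propositional are turned into boolean ones with [`[< _ >]].  The algebra   *)
(* only enters the definitions below through its ring structure.  The ring    *)
(* is allowed to be trivial ([pzRingType]), because the last quotient in the  *)
(* algorithm may be the zero algebra.                                         *)

Section Submodule.
Variables (A : pzRingType) (M : lmodType A) (N : submodClosed M).

Record submod := Submod { submod_val : M; _ : submod_val \in (N : {pred M}) }.

HB.instance Definition _ := [isSub for submod_val].
HB.instance Definition _ := [Choice of submod by <:].
HB.instance Definition _ := [SubChoice_isSubLmodule of submod by <:].

End Submodule.

Section QuotientModule.
Variables (A : pzRingType) (M : lmodType A) (N : submodClosed M).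

Fact submod_zmod_closed : zmod_closed N.
Proof.
split=> [|x y xN yN]; first exact: rpred0.
by rewrite -scaleN1r rpredD // rpredZ.
Qed.

Definition submod_pred : {pred M} := N.

HB.instance Definition _ :=
  GRing.isZmodClosed.Build M submod_pred submod_zmod_closed.

Definition quotmod : Type := {ideal_quot submod_pred}.

HB.instance Definition _ := GRing.Zmodule.on quotmod.
HB.instance Definition _ := EqQuotient.on quotmod.

Definition quotmod_scale (a : A) (x : quotmod) : quotmod :=
  \pi_quotmod (a *: repr x).

Lemma eq_quotmodE (x y : M) :
  (\pi_quotmod x == \pi_quotmod y) = (x - y \in (N : {pred M})).
Proof. by rewrite -(Quotient.idealrBE submod_pred). Qed.

Lemma quotmod_piD (x y : M) :
  \pi_quotmod (x + y) = \pi_quotmod x + \pi_quotmod y.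
Proof. by rewrite (raddfD (\pi_{ideal_quot submod_pred})). Qed.

Lemma quotmod_piZ (a : A) (x : M) :
  quotmod_scale a (\pi_quotmod x) = \pi_quotmod (a *: x).
Proof.
apply/eqP; rewrite eq_quotmodE -scalerBr rpredZ // -eq_quotmodE reprK.
exact: eqxx.
Qed.

Fact quotmod_scaleA a b x :
  quotmod_scale a (quotmod_scale b x) = quotmod_scale (a * b) x.
Proof. by rewrite -[x]reprK (quotmod_piZ b) !quotmod_piZ scalerA. Qed.

Fact quotmod_scale1 : left_id 1 quotmod_scale.
Proof. by move=> x; rewrite -[x]reprK quotmod_piZ scale1r. Qed.

Fact quotmod_scaleDr : right_distributive quotmod_scale +%R.
Proof.
move=> a x y; rewrite -[x]reprK -[y]reprK -quotmod_piD !quotmod_piZ.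
by rewrite scalerDr quotmod_piD.
Qed.

Fact quotmod_scaleDl x : {morph quotmod_scale^~ x : a b / a + b}.
Proof. by move=> a b; rewrite -[x]reprK !quotmod_piZ scalerDl quotmod_piD. Qed.

HB.instance Definition _ := GRing.Zmodule_isLmodule.Build A quotmod
  quotmod_scaleA quotmod_scale1 quotmod_scaleDr quotmod_scaleDl.

End QuotientModule.

(* Noncommutative counterpart of the ideal quotients of [ring_quotient]. *)
HB.mixin Record isTwoSidedIdeal (A : pzRingType) (S : {pred A}) := {
  two_sided_ideal_subproof :
    forall a x, x \in S -> (a * x \in S) && (x * a \in S)
}.

#[short(type="twoSidedIdeal")]
HB.structure Definition TwoSidedIdeal (A : pzRingType) :=
  {S of GRing.ZmodClosed A S & isTwoSidedIdeal A S}.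

Section QuotientRing.
Variables (A : pzRingType) (I : twoSidedIdeal A).

Definition quotring : Type := {ideal_quot I}.

HB.instance Definition _ := GRing.Zmodule.on quotring.
HB.instance Definition _ := EqQuotient.on quotring.

Definition quotring_one : quotring := \pi_quotring 1.
Definition quotring_mul (x y : quotring) : quotring :=
  \pi_quotring (repr x * repr y).

Lemma eq_quotringE (x y : A) :
  (\pi_quotring x == \pi_quotring y) = (x - y \in I).
Proof. by rewrite -(Quotient.idealrBE I). Qed.

Lemma quotring_piD (x y : A) :
  \pi_quotring (x + y) = \pi_quotring x + \pi_quotring y.
Proof. by rewrite (raddfD (\pi_{ideal_quot I})). Qed.

Lemma quotring_piM (x y : A) :
  quotring_mul (\pi_quotring x) (\pi_quotring y) = \pi_quotring (x * y).
Proof.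
have reprB z : repr (\pi_quotring z) - z \in I.
  by rewrite -eq_quotringE reprK.
rewrite /quotring_mul; set x' := repr _; set y' := repr _.
apply/eqP; rewrite eq_quotringE.
have -> : x' * y' - x * y = x' * (y' - y) + (x' - x) * y.
  by rewrite mulrBr mulrBl addrA subrK.
have /andP[Iy _] := two_sided_ideal_subproof x' _ (reprB y).
have /andP[_ Ix] := two_sided_ideal_subproof y _ (reprB x).
exact: rpredD.
Qed.

Fact quotring_mulA : associative quotring_mul.
Proof.
by move=> x y z; rewrite -[x]reprK -[y]reprK -[z]reprK (quotring_piM (repr y))
  (quotring_piM (repr x) (repr y)) !quotring_piM mulrA.
Qed.

Fact quotring_mul1r : left_id quotring_one quotring_mul.
Proof. by move=> x; rewrite -[x]reprK quotring_piM mul1r. Qed.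

Fact quotring_mulr1 : right_id quotring_one quotring_mul.
Proof. by move=> x; rewrite -[x]reprK quotring_piM mulr1. Qed.

Fact quotring_mulDl : left_distributive quotring_mul +%R.
Proof.
move=> x y z; rewrite -[x]reprK -[y]reprK -[z]reprK -quotring_piD.
by rewrite !quotring_piM mulrDl quotring_piD.
Qed.

Fact quotring_mulDr : right_distributive quotring_mul +%R.
Proof.
move=> x y z; rewrite -[x]reprK -[y]reprK -[z]reprK -quotring_piD.
by rewrite !quotring_piM mulrDr quotring_piD.
Qed.

HB.instance Definition _ := GRing.Zmodule_isPzRing.Build quotring
  quotring_mulA quotring_mul1r quotring_mulr1 quotring_mulDl quotring_mulDr.

End QuotientRing.

Section IdempotentIdeal.
Variables (A : pzRingType) (e : A).

(* AeA: the finite sums of elements a * e * b. *)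
Definition idem_ideal : {pred A} :=
  [pred x | `[< exists s : seq (A * A), x = \sum_(q <- s) q.1 * e * q.2 >]].

Fact idem_ideal_zmod_closed : zmod_closed idem_ideal.
Proof.
split=> [|_ _ /asboolP[s ->] /asboolP[t ->]]; apply/asboolP.
  by exists [::]; rewrite big_nil.
exists (s ++ [seq (- q.1, q.2) | q <- t]); rewrite big_cat big_map /=.
rewrite -sumrN; congr (_ + _).
by apply: eq_bigr => q _; rewrite !mulNr.
Qed.

Fact idem_ideal_two_sided a x :
  x \in idem_ideal -> (a * x \in idem_ideal) && (x * a \in idem_ideal).
Proof.
move=> /asboolP[s ->]; apply/andP; split; apply/asboolP.
  exists [seq (a * q.1, q.2) | q <- s]; rewrite big_map mulr_sumr /=.
  by apply: eq_bigr => q _; rewrite !mulrA.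
exists [seq (q.1, q.2 * a) | q <- s]; rewrite big_map mulr_suml /=.
by apply: eq_bigr => q _; rewrite !mulrA.
Qed.

HB.instance Definition _ :=
  GRing.isZmodClosed.Build A idem_ideal idem_ideal_zmod_closed.
HB.instance Definition _ :=
  isTwoSidedIdeal.Build A idem_ideal idem_ideal_two_sided.

End IdempotentIdeal.

Definition isomorphic (A : pzRingType) (M N : lmodType A) : Prop :=
  exists f : {linear M -> N}, bijective f.

(* For N' contained in N, this is the factor N / N'. *)
Section Subquotient.
Variables (A : pzRingType) (M : lmodType A) (N N' : submodClosed M).

Definition restrict_submod : {pred submod N} := [pred x | submod_val x \in N'].

Fact restrict_submod_closed : subsemimod_closed restrict_submod.
Proof.
by split; [split=> [|x y] | move=> a x]; rewrite !inE /= ?rpred0 //;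
  [exact: rpredD | exact: rpredZ].
Qed.

HB.instance Definition _ :=
  GRing.isSubmodClosed.Build A (submod N) restrict_submod
    restrict_submod_closed.

Definition subquotient := quotmod restrict_submod.
HB.instance Definition _ := GRing.Lmodule.on subquotient.

End Subquotient.

(* 0 = F 0 <= F 1 <= ... <= F n = M *)
Definition filtration (A : pzRingType) (M : lmodType A) (n : nat)
    (F : nat -> submodClosed M) : Prop :=
  [/\ forall x : M, x \in F 0 -> x = 0,
      forall x : M, x \in F n
    & forall i, (i < n)%N -> {subset F i <= F i.+1}].

Definition has_filtration (A : pzRingType) (M : lmodType A)
    (C : lmodType A -> Prop) : Prop :=
  exists (n : nat) (F : nat -> submodClosed M),
    filtration n F /\
    forall i, (i < n)%N -> C (subquotient (F i.+1) (F i)).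

Definition simple_module (A : pzRingType) (M : lmodType A) : Prop :=
  (exists x : M, x != 0) /\
  forall N : submodClosed M,
    (forall x : M, x \in N -> x = 0) \/ (forall x : M, x \in N).

(* S occurs as a factor of some composition series of M. *)
Definition composition_factor (A : pzRingType) (M S : lmodType A) : Prop :=
  exists (n : nat) (F : nat -> submodClosed M),
    [/\ filtration n F,
        forall i, (i < n)%N -> simple_module (subquotient (F i.+1) (F i))
      & exists2 i, (i < n)%N & isomorphic (subquotient (F i.+1) (F i)) S].

Definition maximal_submodule (A : pzRingType) (M : lmodType A)
    (N : submodClosed M) : Prop :=
  (exists x : M, x \notin N) /\
  forall N' : submodClosed M, {subset N <= N'} ->
    {subset N' <= N} \/ (forall x : M, x \in N').

Section Radical.
Variables (A : pzRingType) (M : lmodType A).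

Definition radical : {pred M} :=
  [pred x | `[< forall N : submodClosed M, maximal_submodule N -> x \in N >]].

Fact radical_closed : subsemimod_closed radical.
Proof.
split; [split=> [|x y /asboolP xr /asboolP yr] | move=> a x /asboolP xr];
  apply/asboolP=> N Nmax; first exact: rpred0.
  by rewrite rpredD ?xr ?yr.
by rewrite rpredZ ?xr.
Qed.

HB.instance Definition _ :=
  GRing.isSubmodClosed.Build A M radical radical_closed.

End Radical.

Section Trace.
Variables (A : pzRingType) (P M : lmodType A).

(* The finite sums of elements f p with f : P -> M linear. *)
Definition trace : {pred M} :=
  [pred x | `[< exists s : seq ({linear P -> M} * P),
                  x = \sum_(q <- s) q.1 q.2 >]].

Fact trace_closed : subsemimod_closed trace.
Proof.
split; [split=> [|_ _ /asboolP[s ->] /asboolP[t ->]] | move=> a _ /asboolP[s ->]];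
  apply/asboolP.
- by exists [::]; rewrite big_nil.
- by exists (s ++ t); rewrite big_cat.
exists [seq (q.1, a *: q.2) | q <- s]; rewrite big_map scaler_sumr /=.
by apply: eq_bigr => q _; rewrite linearZ.
Qed.

HB.instance Definition _ := GRing.isSubmodClosed.Build A M trace trace_closed.

End Trace.

Section Projective.
Variables (A : pzRingType) (e : A).

Definition left_ideal : {pred A^o} := [pred x | `[< exists a : A, x = a * e >]].

Fact left_ideal_closed : subsemimod_closed left_ideal.
Proof.
split; [split=> [|_ _ /asboolP[a ->] /asboolP[b ->]] | move=> a _ /asboolP[b ->]];
  apply/asboolP.
- by exists 0; rewrite mul0r.
- by exists (a + b); rewrite mulrDl.
by exists (a * b); rewrite -mulrA.
Qed.

HB.instance Definition _ :=
  GRing.isSubmodClosed.Build A A^o left_ideal left_ideal_closed.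

(* P_lambda = A e_lambda and S_lambda = P_lambda / rad P_lambda *)
Definition Proj : lmodType A := submod left_ideal.
Definition Simp : lmodType A := quotmod (@radical A Proj).

End Projective.

Section Stratification.
Variables (A : pzRingType) (Lam : finType) (e : Lam -> A).
(* [r l m] stands for l \preccurlyeq m *)
Variable r : rel Lam.

Definition factors_below (l : Lam) (N : submodClosed (Proj (e l))) : Prop :=
  forall m, composition_factor (quotmod N) (Simp (e m)) -> r m l.

(* K is the kernel of P_l -> Delta_l: the largest quotient of P_l with a      *)
(* given property is the quotient by the smallest submodule.                  *)
Definition standard_kernel (l : Lam) (K : submodClosed (Proj (e l))) : Prop :=
  factors_below K /\
  forall N : submodClosed (Proj (e l)), factors_below N -> {subset K <= N}.

(* The kernels [K l] are unique, so [quotmod (K l)] is Delta_l. *)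
Definition standardly_stratified : Prop :=
  exists K : forall l : Lam, submodClosed (Proj (e l)),
    (forall l, standard_kernel (K l)) /\
    forall l, has_filtration (submod (K l)) (fun Q : lmodType A =>
      exists m, [/\ r l m, m != l & isomorphic Q (quotmod (K m))]).

End Stratification.

Section AlgorithmStep.
Variables (A : pzRingType) (Lam : finType) (X : {set Lam}) (e : Lam -> A).

Definition O1 (l : Lam) : Prop :=
  l \in X /\
  forall m, m \in X -> exists n : nat,
    isomorphic (submod (@trace A (Proj (e l)) (Proj (e m))))
               {ffun 'I_n -> Proj (e l)}.

(* l \leqslant' m *)
Definition O1_le (l m : Lam) : Prop :=
  exists x : Proj (e l), (x \in @trace A (Proj (e m)) (Proj (e l))) && (x != 0).

Definition O1_maximal (s : Lam) : Prop :=
  O1 s /\ forall m, O1 m -> O1_le s m -> m = s.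

End AlgorithmStep.

(* [algorithm s X e]: the algorithm, run on the algebra A with the            *)
(* idempotents (e l) for l in X, can output the chain s = [:: s_1; ...; s_t]. *)
Fixpoint algorithm (Lam : finType) (s : seq Lam) :
    forall A : pzRingType, {set Lam} -> (Lam -> A) -> Prop :=
  match s with
  | [::] => fun A X e => forall l, ~ O1 X e l
  | s1 :: s' => fun A X e =>
      O1_maximal X e s1 /\
      algorithm s' (X :\ s1)
        (fun l => \pi_(quotring (idem_ideal (e s1))) (e l))
  end.

(* s_1 > s_2 > ... > s_t *)
Definition chain_order (Lam : finType) (s : seq Lam) : rel Lam :=
  fun l m => (index m s <= index l s)%N.

(* The set of all linear orders on Lam produced by the algorithm. *)
Definition algorithm_orders (A : pzRingType) (Lam : finType) (e : Lam -> A)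
    (r : rel Lam) : Prop :=
  exists s : seq Lam,
    [/\ algorithm s [set: Lam] e, size s = #|Lam| & r =2 chain_order s].

Definition primitive_idempotent (A : pzRingType) (e : A) : Prop :=
  [/\ e != 0, e * e = e &
    forall f g : A, f * f = f -> g * g = g -> f * g = 0 -> g * f = 0 ->
      e = f + g -> f = 0 \/ g = 0].

(* A is basic: the indecomposable projectives A e_l are pairwise not          *)
(* isomorphic, for (e l) a complete set of primitive orthogonal idempotents.  *)
Definition basic_idempotents (A : pzRingType) (Lam : finType)
    (e : Lam -> A) : Prop :=
  forall l m, l != m -> ~ isomorphic (Proj (e l)) (Proj (e m)).

(* Main.v *)
Require Import Defs.
From HB Require Import structures.
From mathcomp Require Import all_boot all_algebra all_field.
From mathcomp Require Import generic_quotient ring_quotient boolp.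
From Stdlib Require Import Relation_Operators Operators_Properties.

Set Implicit Arguments.
Unset Strict Implicit.
Unset Printing Implicit Defensive.

Import GRing.Theory.
Local Open Scope ring_scope.
Local Open Scope quotient_scope.

(* Let I_j be the ideal generated by e_{s_1}, ..., e_{s_j}, so that the j-th  *)
(* algebra of the algorithm is A / I_j.  For l = s_i, a quotient of P_l has   *)
(* no composition factor S_m with m > l iff it is annihilated by all e_m with *)
(* m > l, hence Delta_l = P_l / I_{i-1} e_l.  Over A / I_j the trace of the   *)
(* projective of s_{j+1} in that of l is I_{j+1} e_l / I_j e_l, so s_{j+1}    *)
(* being in O_1 makes this factor a power of A e_{s_{j+1}} / I_j e_{s_{j+1}}, *)
(* the standard module of s_{j+1}.  Therefore                                 *)
(* 0 = I_0 e_l <= I_1 e_l <= ... <= I_{i-1} e_l filters the kernel.           *)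

(** Both halves of this argument reduce to statements about idempotents. The formula for Delta_l is
    [ideal_part_standard_kernel]. It rests on a criterion for M of finite length: S_m is a
    composition factor of M exactly when e_m M is nonzero ([composition_factor_Simp],
    [Simp_composition_factor]). The step from e_m M nonzero to S_m needs A e_m to have only one
    maximal submodule ([maximal_sub_radical]). This follows from Fitting's dichotomy: for primitive
    e_m, an element of e_m A e_m is nilpotent or left invertible. For the filtration, the trace of
    Be in Bf is the intersection of BeB with Bf ([mem_trace_proj]). Hence membership in O_1 over a
    quotient B of A pulls back to a statement about ideals of A ([O1_presents]).
    [algorithm_stratifies] does this along the whole run, [chain_ffun] cuts each power of Delta_m
    into single copies, and [stratifies_chain] concatenates the pieces. A run of length |Lam| meets
    every l, so every kernel is filtered. *)

Section Modules.
Variable A : pzRingType.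
Implicit Types M D : lmodType A.

(** Packed submodules carry closure proofs, so extensionality needs proof irrelevance. It lets the
    ends of a chain be identified by equality. *)
Lemma submod_ext M (N N' : submodClosed M) :
  (forall x, (x \in N) = (x \in N')) -> N = N'.
Proof.
case: N N' => [f [[a] [b]]] [g [[c] [d]]] /= eqfg.
have efg : f = g by apply/funext => x; exact: eqfg x.
by subst g; rewrite (Prop_irrelevance a c) (Prop_irrelevance b d).
Qed.

Definition mk_submod M (P : {pred M}) (HP : subsemimod_closed P) :
  submodClosed M := HB.pack P (GRing.isSubmodClosed.Build A M P HP).

Lemma submod_comprehension M (P : M -> Prop) :
    P 0 -> (forall a x y, P x -> P y -> P (a *: x + y)) ->
  exists N : submodClosed M, forall x, x \in N <-> P x.
Proof.
move=> P0 PD; have PP : subsemimod_closed [pred x | `[< P x >]].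
  split; [split=> [|x y /asboolP Px /asboolP Py] | move=> a x /asboolP Px].
  - by apply/asboolP.
  - by apply/asboolP; rewrite -[x]scale1r; apply: PD.
  - by apply/asboolP; rewrite -[_ *: _]addr0; apply: PD.
by exists (mk_submod PP) => x; split=> [/asboolP | /asboolP].
Qed.

Lemma isomorphic_of_bijection M D (f : M -> D) :
    (forall a x y, f (a *: x + y) = a *: f x + f y) ->
    (forall x, f x = 0 -> x = 0) -> (forall y, exists x, f x = y) ->
  isomorphic M D.
Proof.
move=> flin finj fsurj.
pose F : {linear M -> D} := HB.pack f (GRing.isLinear.Build A M D *:%R f flin).
exists F; have injF : injective F.
  move=> x y eqF; apply/eqP; rewrite -subr_eq0; apply/eqP/finj.
  by rewrite -[f]/(F : M -> D) linearB eqF subrr.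
pose g y := projT1 (cid (fsurj y)).
have gK : cancel g F by move=> y; rewrite /g; case: (cid _).
by exists g => // x; apply: injF; rewrite gK.
Qed.

Lemma isomorphic_sym M D : isomorphic M D -> isomorphic D M.
Proof.
case=> f [g fK gK]; apply: (@isomorphic_of_bijection _ _ g).
- by move=> a x y; apply: (can_inj fK); rewrite linearP !gK.
- by move=> x gx0; rewrite -[x]gK gx0 linear0.
by move=> y; exists (f y).
Qed.

Lemma quotmod_pi_eq0 M (N : submodClosed M) x :
  (\pi_(quotmod N) x = 0) <-> x \in N.
Proof.
have pi0 : \pi_(quotmod N) 0 = 0.
  by apply: (@addrI _ (\pi_(quotmod N) 0)); rewrite -quotmod_piD !addr0.
split=> [/eqP | xN]; first by rewrite -pi0 eq_quotmodE subr0.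
by apply/eqP; rewrite -pi0 eq_quotmodE subr0.
Qed.

Lemma quotmod_pi_lin M (N : submodClosed M) a x y :
  \pi_(quotmod N) (a *: x + y) = a *: \pi_(quotmod N) x + \pi_(quotmod N) y.
Proof. by rewrite quotmod_piD -quotmod_piZ. Qed.

Lemma quotmod_scale_pi M (N : submodClosed M) a x :
  a *: \pi_(quotmod N) x = \pi_(quotmod N) (a *: x).
Proof. exact: quotmod_piZ. Qed.

Lemma first_isomorphism M D (N : submodClosed M) (f : M -> D) :
    (forall a x y, f (a *: x + y) = a *: f x + f y) ->
    (forall y, exists x, f x = y) -> (forall x, f x = 0 <-> x \in N) ->
  isomorphic (quotmod N) D.
Proof.
move=> flin fsurj fker.
pose g (q : quotmod N) := f (repr q).
(* The induced map is evaluated on a chosen representative; this is its independence of that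
   choice. *)
have gpi x : g (\pi_(quotmod N) x) = f x.
  have : repr (\pi_(quotmod N) x) - x \in N by rewrite -eq_quotmodE reprK.
  move/fker=> f0; rewrite /g -[LHS](subrK (f x)) -[RHS]add0r; congr (_ + _).
  rewrite -f0 addrC -[repr _ - x]addrC -[- x]scaleN1r flin scaleN1r.
  by [].
apply: (@isomorphic_of_bijection _ _ g) => [a q q'|q|y].
- by rewrite -[q]reprK -[q']reprK -quotmod_pi_lin !gpi flin.
- by rewrite -[q]reprK gpi => /fker/quotmod_pi_eq0.
by have [x <-] := fsurj y; exists (\pi_(quotmod N) x); rewrite gpi.
Qed.

End Modules.

(** * Presentations of subquotients and chains of submodules *)

(* [f] induces a bijection from N' / N onto [D], semilinear along [p].  The   *)
(* values of [f] outside N' are irrelevant, which avoids the subtypes.        *)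
Record presents (A B : pzRingType) (p : A -> B) (M : lmodType A)
    (D : lmodType B) (N' N : submodClosed M) (f : M -> D) : Prop := Presents {
  presents_lin : forall a x y, x \in N' -> y \in N' ->
    f (a *: x + y) = p a *: f x + f y;
  presents_surj : forall d, exists2 x, x \in N' & f x = d;
  presents_ker : forall x, x \in N' -> (f x = 0 <-> x \in N) }.

Section Presents.
Variable A : pzRingType.
Implicit Types M D : lmodType A.

Lemma presents_isomorphic M D (N' N : submodClosed M) (f : M -> D) :
  presents id N' N f -> isomorphic (subquotient N' N) D.
Proof.
case=> flin fsurj fker.
apply: (@first_isomorphism _ _ _ _ (fun x : submod N' => f (submod_val x))).
- by move=> a [x xN] [y yN] /=; rewrite flin.
- by move=> d; have [x xN <-] := fsurj d; exists (Submod xN).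
by move=> [x xN]; apply: fker.
Qed.

(** Standard stratification asks for a filtration of the kernel as a module in its own right, so
    presentations found in the ambient module are moved into the submodule K. *)
Lemma presents_restrict M D (K N' N : submodClosed M) (f : M -> D) :
    {subset N' <= K} -> presents id N' N f ->
  presents id (@restrict_submod _ _ K N') (@restrict_submod _ _ K N)
    (fun x : submod K => f (submod_val x)).
Proof.
move=> sN'K [flin fsurj fker]; split.
- by move=> a x y xN yN; apply: flin.
- by move=> d; have [x xN <-] := fsurj d; exists (Submod (sN'K x xN)).
by move=> x; apply: fker.
Qed.

Definition step M (C : lmodType A -> Prop) (N N' : submodClosed M) : Prop :=
  {subset N <= N'} /\ C (subquotient N' N).

(** Filtrations as a reflexive transitive closure: concatenation becomes transitivity, and the
    indexing by numbers is recovered only at the end, in [chain_nat]. *)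
Definition chain M (C : lmodType A -> Prop) :=
  clos_refl_trans (submodClosed M) (step C).

Lemma chain_nat M (C : lmodType A -> Prop) (N N' : submodClosed M) :
    chain C N N' ->
  exists n (F : nat -> submodClosed M),
    [/\ F 0%N = N, F n = N' & forall i, (i < n)%N -> step C (F i) (F i.+1)].
Proof.
move=> NN1; have {NN1} := @clos_rt_rt1n _ _ _ _ NN1;
  elim=> {N N'} [N|N N1 N' NN1 _ [n [F [F0 Fn FS]]]].
  by exists 0%N, (fun=> N).
exists n.+1, (fun i => if i is j.+1 then F j else N); split=> //.
by case=> [|i] lt_i_n; [rewrite F0 | apply: FS].
Qed.

Lemma chain_filtration M (C : lmodType A -> Prop) (N N' : submodClosed M) :
    chain C N N' -> (forall x, x \in N -> x = 0) -> (forall x, x \in N') ->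
  exists (n : nat) (F : nat -> submodClosed M),
    [/\ filtration n F,
        forall i, (i < n)%N -> C (subquotient (F i.+1) (F i)),
        F 0%N = N & F n = N'].
Proof.
move=> /chain_nat[n [F [F0 Fn FS]]] N0 N'T.
exists n, F; split=> //; last by move=> i /FS[].
by split=> [x|x|i /FS[]//]; rewrite ?F0 ?Fn //; apply: N0.
Qed.

(* The intermediate submodules are the joint kernels in N' of the coordinates *)
(* of [f] from j on.                                                          *)
Lemma chain_ffun M D (C : lmodType A -> Prop) n (N' N : submodClosed M)
    (f : M -> {ffun 'I_n -> D}) :
    (forall Q, isomorphic Q D -> C Q) -> {subset N <= N'} ->
    presents id N' N f ->
  chain C N N'.
Proof.
move=> CD sNN' [flin fsurj fker].
have f0 : f 0 = 0 by apply/fker; exact: rpred0.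
have HG j : exists G : submodClosed M, forall x, x \in G <->
    x \in N' /\ forall i : 'I_n, (j <= i)%N -> f x i = 0.
  apply: submod_comprehension => [|a x y [xN fx] [yN fy]].
    by split=> [|i _]; rewrite ?rpred0 // f0 ffunE.
  split=> [|i le_ji]; first by rewrite rpredD ?rpredZ.
  by rewrite flin // !ffunE fx // fy // scaler0 addr0.
have [G GP] := choice HG.
have GS j : (j < n)%N -> step C (G j) (G j.+1).
  move=> ltjn; pose i0 := Ordinal ltjn; split=> [x /GP[xN fx]|].
    by apply/GP; split=> // i /ltnW; apply: fx.
  apply/CD/(@presents_isomorphic _ _ _ _ (fun x => f x i0)); split.
  - by move=> a x y /GP[xN _] /GP[yN _]; rewrite flin // !ffunE.
  - move=> d; have [x xN fx] := fsurj [ffun i => if i == i0 then d else 0].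
    exists x; last by rewrite fx ffunE eqxx.
    apply/GP; split=> // i lt_ji; rewrite fx ffunE -val_eqE /= gtn_eqF //.
  move=> x /GP[xN fx]; split=> [fx0|/GP[_]]; last exact.
  apply/GP; split=> // i; rewrite leq_eqVlt => /orP[/eqP eij|]; last exact: fx.
  by rewrite (_ : i = i0) //; apply: val_inj.
have GC j : (j <= n)%N -> chain C (G 0%N) (G j).
  elim: j => [_|j IHj ltjn]; first exact: rt_refl.
  by apply: rt_trans (IHj (ltnW ltjn)) _; apply/rt_step/GS.
have <- : G n = N'.
  apply: submod_ext => x; apply/idP/idP => [/GP[]//|xN].
  by apply/GP; split=> // i; rewrite leqNgt ltn_ord.
have <- : G 0%N = N; last exact: GC.
apply: submod_ext => x; apply/idP/idP => [/GP[xN fx]|xN].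
  by apply/(fker _ xN)/ffunP => i; rewrite fx // ffunE.
apply/GP; split=> [|i _]; first exact: sNN'.
by rewrite (_ : f x = 0) ?ffunE //; apply/(fker _ (sNN' _ xN)).
Qed.

End Presents.

(** * Finite length and composition series *)

(** Any strictly monotone numerical function on submodules serves as a length. It is bounded by its
    value at the whole module, so extremal submodules exist. *)
Definition finite_length (A : pzRingType) (M : lmodType A) : Prop :=
  exists d : submodClosed M -> nat, forall N N' : submodClosed M,
    {subset N <= N'} -> (exists2 x, x \in N' & x \notin N) -> (d N < d N')%N.

Section FiniteLength.
Variable A : pzRingType.
Implicit Types M S : lmodType A.

Lemma exists_top M : exists T : submodClosed M, forall x, x \in T.
Proof.
have [//|//|T TP] := @submod_comprehension A M (fun=> True).
by exists T => x; apply/TP.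
Qed.

Lemma exists_zero M : exists Z : submodClosed M, forall x, x \in Z <-> x = 0.
Proof.
by apply: submod_comprehension => // a x y -> ->; rewrite scaler0 addr0.
Qed.

Lemma not_subset M (N N' : submodClosed M) :
  ~ {subset N <= N'} -> exists2 x, x \in N & x \notin N'.
Proof.
move=> nsub; apply: contrapT => nex; apply: nsub => x xN.
by apply/negPn/negP => xN'; apply: nex; exists x.
Qed.

Lemma finite_length_quot M (K : submodClosed M) :
  finite_length M -> finite_length (quotmod K).
Proof.
case=> d dP.
have HF (N : submodClosed (quotmod K)) : exists F : submodClosed M,
    forall x, x \in F <-> \pi_(quotmod K) x \in N.
  apply: submod_comprehension => [|a x y xN yN].
    by rewrite (_ : \pi_(quotmod K) 0 = 0) ?rpred0 //;
      apply/quotmod_pi_eq0/rpred0.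
  by rewrite quotmod_pi_lin rpredD ?rpredZ.
have [F FP] := choice HF; exists (fun N => d (F N)) => N N' sNN' [x xN' xN].
apply: dP => [y /FP yN|]; first exact/FP/sNN'.
exists (repr x); first by apply/FP; rewrite reprK.
by apply/negP => /FP; rewrite reprK; apply/negP.
Qed.

(** A proper submodule of greatest [d] is maximal; the zero submodule shows that proper ones
    exist. *)
Lemma exists_maximal_submodule M :
    finite_length M -> (exists x : M, x != 0) ->
  exists N : submodClosed M, maximal_submodule N.
Proof.
case=> d dP [x0 x0n0]; have [T TT] := exists_top M.
have [Z ZP] := exists_zero M.
pose Q v := `[< exists N : submodClosed M, (exists x, x \notin N) /\ d N = v >].
have exQ : exists v, Q v.
  exists (d Z); apply/asboolP; exists Z; split=> //; exists x0.
  by apply/negP => /ZP/eqP; apply/negP.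
have ubQ v : Q v -> (v <= d T)%N.
  by move=> /asboolP[N [[x xN] <-]]; apply/ltnW/dP; [move=> y _| exists x].
case: (ex_maxnP exQ ubQ) => v /asboolP[N [Nx dN]] vmax; exists N;
  split=> // N' sNN'.
have [sN'N|nsN'N] := pselect {subset N' <= N}; first by left.
right=> x; apply/negPn/negP => xN'.
have : Q (d N') by apply/asboolP; exists N'; split=> //; exists x.
by move/vmax; rewrite -dN leqNgt dP //; apply: not_subset.
Qed.

(** Among the submodules strictly above N, take N' of least [d]. The preimage F of a submodule of N'
    / N lies between N and N', and minimality makes it one of the two. *)
Lemma exists_simple_step M (N : submodClosed M) :
    finite_length M -> (exists x, x \notin N) ->
  exists N' : submodClosed M,
    [/\ {subset N <= N'}, exists2 x, x \in N' & x \notin N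
      & simple_module (subquotient N' N)].
Proof.
case=> d dP [x0 x0N]; have [T TT] := exists_top M.
pose Q v := `[< exists N' : submodClosed M,
  [/\ {subset N <= N'}, exists2 x, x \in N' & x \notin N & d N' = v] >].
have exQ : exists v, Q v.
  by exists (d T); apply/asboolP; exists T; split=> //; exists x0.
case: (ex_minnP exQ) => v /asboolP[N' [sNN' [x xN' xN] dN']] vmin.
exists N'; split=> //; first by exists x.
split=> [|R].
  exists (\pi_(subquotient N' N) (Submod xN')).
  by apply/eqP => /quotmod_pi_eq0; apply/negP.
have [|a y z [u <- uR] [w <- wR]|F FP] := @submod_comprehension A M (fun y =>
  exists2 u : submod N', submod_val u = y & \pi_(subquotient N' N) u \in R).
- exists 0 => //; rewrite (_ : \pi_(subquotient N' N) 0 = 0) ?rpred0 //.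
  by apply/quotmod_pi_eq0/rpred0.
- by exists (a *: u + w) => //; rewrite quotmod_pi_lin rpredD ?rpredZ.
have sFN' : {subset F <= N'} by move=> _ /FP[u <- _]; apply: (valP u).
have sNF : {subset N <= F}.
  move=> y yN; apply/FP; exists (Submod (sNN' y yN)) => //.
  by rewrite (_ : \pi_(subquotient N' N) _ = 0) ?rpred0 //;
    apply/quotmod_pi_eq0.
have [sFN|/not_subset nsFN] := pselect {subset F <= N}.
  left=> q qR; rewrite -[q]reprK; apply/quotmod_pi_eq0/sFN/FP.
  by exists (repr q); rewrite ?reprK.
right=> q; have [sN'F|/not_subset nsN'F] := pselect {subset N' <= F}.
  have /sN'F/FP[u /val_inj eu] := valP (repr q).
  by rewrite -[q]reprK -eu.
have /vmin : Q (d F) by apply/asboolP; exists F.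
by rewrite -dN' leqNgt dP.
Qed.

Lemma composition_chain M (N T : submodClosed M) :
    finite_length M -> (forall x, x \in T) ->
  chain (@simple_module A) N T.
Proof.
move=> finM TT; have [d dP] := finM.
have [k] := ubnP (d T - d N)%N; elim: k => // k IHk in N *;
  rewrite ltnS => le_k.
have [[x xN]|Nfull] := pselect (exists x, x \notin N); last first.
  rewrite (_ : N = T); first exact: rt_refl.
  apply: submod_ext => x; rewrite TT; apply/negPn/negP => xN.
  by apply: Nfull; exists x.
have [|N' [sNN' nsN'N simpN']] := exists_simple_step finM (N := N).
  by exists x.
apply: (rt_trans _ _ _ N'); first exact: rt_step.
apply: IHk; apply: leq_trans le_k; apply: ltn_sub2l; last exact: dP.
by apply: dP => [y _|]; [exact: TT | exists x].
Qed.

End FiniteLength.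

(** * The modules Ae and their tops *)

Section Projectives.
Variable A : pzRingType.
Implicit Types M : lmodType A.

Lemma left_idealP (e x : A) : e * e = e -> (x \in left_ideal e) <-> x * e = x.
Proof.
move=> ee; split=> [/asboolP[a ->]|<-]; first by rewrite -mulrA ee.
by apply/asboolP; exists x.
Qed.

(** Total in a, so no membership proof has to be supplied; [proj_elt e 1] is the generator e of
    Ae. *)
Definition proj_elt (e a : A) : Proj e :=
  @Submod A A^o (left_ideal e) (a * e)
    (introT (asboolP _) (ex_intro _ a erefl)).

Lemma proj_eltK (e : A) : e * e = e -> forall x : Proj e,
  proj_elt e (submod_val x) = x.
Proof. by move=> ee x; apply/val_inj/(left_idealP _ ee)/(valP x). Qed.

Lemma proj_elt_lin (e a b c : A) :
  proj_elt e (a * b + c) = a *: proj_elt e b + proj_elt e c.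
Proof. by apply/val_inj; rewrite /= mulrDl -mulrA. Qed.

Lemma proj_elt1 (e : A) : e * e = e ->
  forall x : Proj e, x = (submod_val x : A) *: proj_elt e 1.
Proof.
by move=> ee x; apply/val_inj; rewrite /= mul1r;
  apply/esym/(left_idealP _ ee)/(valP x).
Qed.

(** The class of e in [Simp e] is fixed by e, and it is nonzero because some maximal submodule of Ae
    omits the generator. It is carried to the subquotient, and e times a representative is the
    required element of M. *)
Lemma composition_factor_Simp (e : A) M :
    e * e = e -> finite_length (Proj e) -> e != 0 ->
    composition_factor M (Simp e) ->
  exists2 x : M, e *: x = x & x != 0.
Proof.
move=> ee finP e0 [n [F [Ffil _ [i lt_in isoS]]]].
have [|N Nmax] := exists_maximal_submodule finP.
  exists (proj_elt e 1); apply: contra_neq e0 => /(congr1 val).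
  by rewrite /= mul1r.
have pi0 : \pi_(Simp e) (proj_elt e 1) != 0.
  apply/eqP => /quotmod_pi_eq0/asboolP/(_ N Nmax) eN; case: Nmax => [[x]].
  by rewrite (proj_elt1 ee x) rpredZ.
have [f [g fK gK]] := isoS.
pose q := g (\pi_(Simp e) (proj_elt e 1)); pose y := repr q.
have qE : e *: q = q.
  apply: (can_inj fK); rewrite linearZ gK;
    apply: etrans (quotmod_scale_pi _ _ _) _.
  congr (\pi_(Simp e) _); by apply/val_inj; rewrite /= mul1r.
exists (e *: submod_val y); first by rewrite scalerA ee.
apply/eqP => ey0; move: pi0; rewrite -[\pi_(Simp e) _]gK -/q -qE -[q]reprK -/y.
suff -> : e *: \pi_(subquotient (F i.+1) (F i)) y = 0 by rewrite linear0 eqxx.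
apply: etrans (quotmod_scale_pi _ _ _) _; apply/quotmod_pi_eq0.
have -> : e *: y = 0 by apply/val_inj.
exact: rpred0.
Qed.

(* The step of a composition series at which x dies is a simple quotient of   *)
(* Ae, hence isomorphic to Simp e as Ae is local.                             *)
Lemma Simp_composition_factor (e : A) M (x : M) :
    e * e = e -> finite_length M ->
    (forall N : submodClosed (Proj e), maximal_submodule N -> 
      {subset N <= @radical A (Proj e)}) ->
    e *: x = x -> x != 0 ->
  composition_factor M (Simp e).
Proof.
move=> ee finM local ex x0.
have [T TT] := exists_top M; have [Z ZP] := exists_zero M.
have [|n [F [Ffil FS F0 Fn]]] := chain_filtration (composition_chain Z finM
  TT) _ TT.
  by move=> y /ZP.
have exi : exists i, x \in F i by exists n; rewrite Fn TT.
case: (ex_minnP exi) => -[|i] xFi imin.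
  by move: xFi; rewrite F0 => /ZP/eqP; rewrite (negPf x0).
have xNi : x \notin F i by apply/negP => /imin; rewrite ltnn.
have lt_in : (i < n)%N.
  by rewrite ltnNge; apply/negP => le_ni; have := imin n;
    rewrite Fn TT ltnNge le_ni => /(_ isT).
exists n, F; split=> //; exists i => //; apply: isomorphic_sym.
have [_ simpF] := FS i lt_in.
pose q := \pi_(subquotient (F i.+1) (F i)) (Submod xFi).
have eq : e *: q = q.
  by apply: etrans (quotmod_scale_pi _ _ _) _;
    congr (\pi_(subquotient _ _) _); apply/val_inj.
have q0 : q != 0 by apply/eqP => /quotmod_pi_eq0; apply/negP.
pose f (y : Proj e) := (submod_val y : A) *: q.
have flin a y z : f (a *: y + z) = a *: f y + f z.
  by rewrite /f /= scalerDl scalerA.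
have f1 : f (proj_elt e 1) = q by rewrite /f /= mul1r.
have f0 : f 0 = 0 by rewrite /f /= scale0r.
have fsurj r : exists y, f y = r.
  have [|a _ _ [y <-] [z <-]|R RP] := @submod_comprehension _ _ (fun r =>
    exists y, f y = r).
  - by exists 0.
  - by exists (a *: y + z); rewrite flin.
  case: (simpF R) => [R0|Rfull]; last exact/RP.
  by move: q0; rewrite (R0 q) ?eqxx //; apply/RP; exists (proj_elt e 1).
have [|a y z /= fy fz|K KP] := @submod_comprehension _ (Proj e) (fun y => f y
  = 0).
- by [].
- by rewrite flin fy fz scaler0 addr0.
have Kmax : maximal_submodule K.
  split; first by exists (proj_elt e 1); apply/negP => /KP; rewrite f1;
    apply/eqP.
  move=> N' sKN'.
  have [|a _ _ [y yN <-] [z zN <-]|R RP] := @submod_comprehension _ _ (fun r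
    => exists2 y, y \in N' & f y = r).
  - by exists 0; rewrite ?rpred0.
  - by exists (a *: y + z); rewrite ?flin // rpredD ?rpredZ.
  case: (simpF R) => [R0|Rfull]; [left=> y yN|right=> y].
    by apply/KP/R0/RP; exists y.
  have /RP[z zN fzy] := Rfull (f y).
  rewrite -[y](subrK z) rpredD //; apply/sKN'/KP.
  by rewrite addrC -scaleN1r flin fzy scaleN1r addNr.
(* K is maximal, so it contains the radical; by [local] it also lies in the radical. *)
apply: (first_isomorphism flin) => // y;
  split=> [/KP/(local K Kmax)//|/asboolP/(_ K Kmax)/KP//].
Qed.

End Projectives.

(** * Finite-dimensional algebras and primitive idempotents *)

Section FiniteDimensional.
Variables (k : fieldType) (A : falgType k).

(** The length of N is the greatest dimension of a subspace of A contained in N. Adjoining to such a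
    subspace a vector outside N raises it. *)
Lemma finite_length_proj (e : A) : finite_length (Proj e).
Proof.
pose Q (N : submodClosed (Proj e)) (v : nat) := `[< exists U : {vspace A},
  \dim U = v /\
  forall u, u \in U -> exists2 x : Proj e, x \in N & submod_val x = u >].
have exQ (N : submodClosed (Proj e)) : exists v, Q N v.
  exists 0%N; apply/asboolP; exists 0%VS; split; first exact: dimv0.
  by move=> u; rewrite memv0 => /eqP ->; exists 0; rewrite ?rpred0.
have ubQ N v : Q N v -> (v <= \dim {:A})%N.
  by move=> /asboolP[U [<- _]]; apply/dimvS/subvf.
exists (fun N => ex_maxn (exQ N) (@ubQ N)) => N N' sNN' [x xN' xN].
case: ex_maxnP => v /asboolP[U [<- UN]] _; case: ex_maxnP => v' _ maxN'.
pose W := (U + <[submod_val x : A]>)%VS.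
apply: (@leq_trans (\dim W)).
  rewrite (ltn_leqif (dimv_leqif_sup (addvSl _ _))) subv_add subvv /= -memvE.
  by apply/negP => /UN[y yN /val_inj eyx]; rewrite -eyx yN in xN.
apply/maxN'/asboolP; exists W; split=> // w.
move=> /memv_addP[u /UN[y yN <-] [_ /vlineP[c ->] ->]].
exists (y + c%:A *: x); first by rewrite rpredD ?rpredZ // sNN'.
by congr (_ + _); exact: (@mulr_algl k A c (submod_val x)).
Qed.

(* If dim A x^n is minimal then x^n = b x^(2n), and right multiplication by   *)
(* x^n is injective on A x^n, which makes b x^n an idempotent of eAe.         *)
Lemma primitive_nilpotent_or_invertible (e x : A) :
    primitive_idempotent e -> e * x = x -> x * e = x ->
  (exists n, x ^+ n.+1 = 0) \/ exists b, e = b * x.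
Proof.
case=> [e0 ee eprim] ex xe.
pose V n := (amulr (x ^+ n.+1) @: fullv)%VS.
have VP n y : reflect (exists a, y = a * x ^+ n.+1) (y \in V n).
  apply: (iffP memv_imgP) => [[a _ ->]|[a ->]]; exists a; rewrite ?memvf //;
  by rewrite lfunE.
have exV : exists v, `[< exists n, \dim (V n) = v >].
  by exists (\dim (V 0%N)); apply/asboolP; exists 0%N.
case: (ex_minnP exV) => v /asboolP[n dimV] vmin.
(* [V n] is A x^(n+1), so the index [n.+1 + n] stands for the exponent 2(n+1). *)
have VnE : (V n <= V (n.+1 + n)%N)%VS.
  have sV : (V (n.+1 + n)%N <= V n)%VS.
    apply/subvP => y /VP[a ->]; apply/VP; exists (a * x ^+ n.+1).
    by rewrite -mulrA -exprD addnS.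
  rewrite -(dimv_leqif_sup sV) eqn_leq dimvS //= dimV.
  by apply: vmin; apply/asboolP; exists (n.+1 + n)%N.
have /VP[b0 b0E] : x ^+ n.+1 \in V (n.+1 + n)%N.
  by apply: (subvP VnE); apply/VP; exists 1; rewrite mul1r.
have exn : e * x ^+ n.+1 = x ^+ n.+1 by rewrite exprS mulrA ex.
have xne : x ^+ n.+1 * e = x ^+ n.+1 by rewrite exprSr -mulrA xe.
(* Right multiplication by x^(n+1) maps [V n] onto itself, so its kernel there is zero by
   rank-nullity. *)
have inj y : y \in V n -> y * x ^+ n.+1 = 0 -> y = 0.
  move=> yV yx0.
  have := limg_ker_dim (amulr (x ^+ n.+1)) (V n).
  have -> : (amulr (x ^+ n.+1) @: V n)%VS = V n.
    apply/eqP; rewrite eqEsubv; apply/andP; split; apply/subvP => z.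
      case/memv_imgP=> w _ ->; rewrite lfunE /=; apply/VP.
      by exists w.
    move/(subvP VnE)/VP=> [a ->]; apply/memv_imgP.
    exists (a * x ^+ n.+1); first by apply/VP; exists a.
    by rewrite lfunE /= -mulrA -exprD addnS.
  rewrite -[RHS]add0n => /addIn/eqP; rewrite dimv_eq0 => /eqP cap0.
  apply/eqP; rewrite -memv0 -cap0; apply/memv_capP; split=> //.
  by rewrite memv_ker lfunE /= yx0.
pose f := e * b0 * x ^+ n.+1.
have fx : f * x ^+ n.+1 = x ^+ n.+1.
  by rewrite /f -!mulrA -exprD addnS -b0E.
have ff : f * f = f.
  apply/eqP; rewrite -subr_eq0; apply/eqP/inj.
    by apply/VP; exists (f * e * b0 - e * b0); rewrite mulrBl /f !mulrA.
  by rewrite mulrBl -mulrA !fx subrr.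
have ef : e * f = f by rewrite /f !mulrA ee.
have fe : f * e = f by rewrite /f -mulrA xne.
(* If f = 0 then x^(n+1) = f x^(n+1) vanishes; if f = e then e = (e b0 x^n) x. *)
have [||||f0|ef0] := eprim f (e - f) ff.
- by rewrite mulrBr !mulrBl ee ef fe ff subrr subr0.
- by rewrite mulrBr fe ff subrr.
- by rewrite mulrBl ef ff subrr.
- by rewrite addrC subrK.
- by left; exists n; rewrite -fx f0 mul0r.
right; exists (e * b0 * x ^+ n); rewrite -mulrA -exprSr -/f.
by apply/eqP; rewrite -subr_eq0 ef0.
Qed.

(** For nilpotent x the geometric series writes e - x^(n+1), which is e for large n, as a left
    multiple of e - x. *)
Lemma primitive_local (e x : A) :
    primitive_idempotent e -> e * x = x -> x * e = x ->
  (exists b, e = b * x) \/ exists b, e = b * (e - x).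
Proof.
move=> eprim ex xe.
have [[n xn0]|] := primitive_nilpotent_or_invertible eprim ex xe; last by left.
right; suff [b be] : exists b, e - x ^+ n.+1 = b * (e - x).
  by exists b; rewrite -be xn0 subr0.
elim: n {xn0} => [|n [b bE]]; first by exists 1; rewrite mul1r.
have xne : x ^+ n.+1 * e = x ^+ n.+1 by rewrite exprSr -mulrA xe.
by exists (b + x ^+ n.+1); rewrite mulrDl -bE mulrBr xne -exprSr addrA subrK.
Qed.

(** If N were not inside another maximal N2, then N + N2 would be Ae and e = u + v. One of eu and ev
    = e - eu has e as a left multiple, so N or N2 would contain the generator. *)
Lemma maximal_sub_radical (e : A) : primitive_idempotent e ->
  forall N : submodClosed (Proj e), maximal_submodule N ->
    {subset N <= @radical A (Proj e)}.
Proof.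
move=> eprim N [[z zN] _] x xN; have [_ ee _] := eprim.
have e1 a (y : Proj e) : a * (e * submod_val y) = e ->
    proj_elt e 1 = a *: (e *: y).
  by move=> aE; apply/val_inj; rewrite /= mul1r -[LHS]aE.
apply/asboolP => N2 [[z2 z2N2] N2max].
apply/negPn/negP => xN2.
have [|a _ _ [u [v [uN vN ->]]] [u' [v' [uN' vN' ->]]]|W WP] :=
  @submod_comprehension A (Proj e)
    (fun y => exists u v, [/\ u \in N, v \in N2 & y = u + v]).
- by exists 0, 0; rewrite !rpred0 addr0.
- exists (a *: u + u'), (a *: v + v'); rewrite !rpredD ?rpredZ //; split=> //.
  by rewrite scalerDr addrACA.
have [|sWN2|/(_ (proj_elt e 1))/WP[u [v [uN vN uvE]]]] := N2max W.
- by move=> y yN2; apply/WP; exists 0, y; rewrite rpred0 add0r.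
- by case/negP: xN2; apply/sWN2/WP; exists x, 0; rewrite rpred0 addr0.
have ue : (submod_val u : A) * e = submod_val u.
  exact/(left_idealP _ ee)/(valP u).
have uve : e - e * submod_val u = e * submod_val v.
  have := congr1 (fun y : Proj e => e * (submod_val y : A)) uvE.
  rewrite /= mul1r ee => eE.
  by apply/eqP; rewrite subr_eq addrC -mulrDr; apply/eqP.
have [||[b bE]|[b]] := primitive_local (x := e * submod_val u) eprim.
- by rewrite mulrA ee.
- by rewrite -mulrA ue.
- case/negP: zN; rewrite (proj_elt1 ee z) rpredZ // (e1 b u) //.
  by rewrite !rpredZ.
rewrite uve => bE; case/negP: z2N2;
  rewrite (proj_elt1 ee z2) rpredZ // (e1 b v) //.
by rewrite !rpredZ.
Qed.

End FiniteDimensional.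

(** * Ideals generated by several idempotents *)

Section IdempotentIdeals.
Variables (A : pzRingType) (Lam : finType) (e : Lam -> A).
Implicit Types (t : seq Lam) (l m : Lam).

Inductive idem_sum t : A -> Prop :=
| IdemSum0 : idem_sum t 0
| IdemSumD a l b x : l \in t -> idem_sum t x -> idem_sum t (a * e l * b + x).

Lemma idem_sum1 t a l b : l \in t -> idem_sum t (a * e l * b).
Proof. by move=> lt; rewrite -[_ * b]addr0; apply: IdemSumD => //; left. Qed.

Lemma idem_sum_add t x y : idem_sum t x -> idem_sum t y -> idem_sum t (x + y).
Proof.
move=> tx ty; elim: tx => [|a l b z lt _ IH]; first by rewrite add0r.
by rewrite -addrA; right.
Qed.

Lemma idem_sum_mull t a x : idem_sum t x -> idem_sum t (a * x).
Proof.
elim=> [|b l c z lt _ IH]; first by rewrite mulr0; left.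
by rewrite mulrDr !mulrA; right.
Qed.

Lemma idem_sum_mulr t a x : idem_sum t x -> idem_sum t (x * a).
Proof.
elim=> [|b l c z lt _ IH]; first by rewrite mul0r; left.
by rewrite mulrDl -!mulrA [b * _]mulrA; right.
Qed.

Lemma idem_sum_sub t t' x : {subset t <= t'} -> idem_sum t x -> idem_sum t' x.
Proof.
by move=> st; elim=> [|a l b z lt _ IH]; [left | right=> //; apply: st].
Qed.

Fact ideal_part_closed t m :
  GRing.subsemimod_closed [pred x : Proj (e m) | `[< idem_sum t (submod_val x)
    >]].
Proof.
split; [split=> [|x y /asboolP tx /asboolP ty] | move=> a x /asboolP tx].
- by apply/asboolP; left.
- by apply/asboolP; apply: idem_sum_add.
- by apply/asboolP; apply: idem_sum_mull.
Qed.

(* I_j e_m, for t = s_1, ..., s_j *)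
Definition ideal_part t m : submodClosed (Proj (e m)) :=
  mk_submod (@ideal_part_closed t m).

Lemma ideal_partP t m x : x \in ideal_part t m <-> idem_sum t (submod_val x).
Proof. by split=> [/asboolP|tx] //; apply/asboolP. Qed.

(** The trace of a run on the fixed algebra A, whereas [algorithm] changes the ring at every step: t
    lists the idempotents already factored out, X the indices left. The quotient by [ideal_part t l]
    is the future Delta_l. *)
Fixpoint stratifies t (X : {set Lam}) (s : seq Lam) : Prop :=
  if s is l :: s' then
    [/\ l \in X,
        forall m, m \in X -> exists n (f : Proj (e m) -> {ffun 'I_n -> quotmod
          (ideal_part t l)}),
          presents id (ideal_part (rcons t l) m) (ideal_part t m) f
      & stratifies (rcons t l) (X :\ l) s']
  else True.

Lemma stratifies_uniq t X s : stratifies t X s -> uniq s /\ {subset s <= X}.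
Proof.
elim: s t X => [|l s IHs] t X //= [lX _ /IHs[us sX]]; split.
  by rewrite us andbT; apply/negP => /sX; rewrite !inE eqxx.
by move=> m; rewrite inE => /predU1P[->//|/sX/setD1P[]].
Qed.

End IdempotentIdeals.

(** * One step of the algorithm, lifted to A *)

(** A homomorphism g from Be satisfies g(y) = y e g(e); conversely, right multiplication by c f maps
    Be into Bf. *)
Lemma mem_trace_proj (B : pzRingType) (e f : B) : e * e = e -> f * f = f ->
  forall x : Proj f, x \in @trace B (Proj e) (Proj f) <-> submod_val x \in
    idem_ideal e.
Proof.
move=> ee ff x; split.
  case/asboolP=> s ->; elim: s => [|[g y] s IHs].
    by rewrite big_nil; apply: rpred0.
  rewrite big_cons; apply: rpredD IHs; apply/asboolP.
  exists [:: (submod_val y, submod_val (g (proj_elt e 1)))].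
  rewrite big_seq1 /= {1}(proj_elt1 ee y) linearZ /= -mulrA; congr (_ * _).
  have {1}-> : proj_elt e 1 = e *: proj_elt e 1.
    by apply/val_inj; rewrite /= mul1r; exact/esym.
  by rewrite linearZ.
case/asboolP=> s sE; apply/asboolP.
pose g0 (c : B) (y : Proj e) : Proj f := proj_elt f ((submod_val y : B) * c).
have g_lin c : linear (g0 c).
  by move=> a y z; apply/val_inj; rewrite /= !mulrDl -!mulrA.
pose g c : {linear Proj e -> Proj f} := HB.pack (g0 c)
  (GRing.isLinear.Build B (Proj e) (Proj f) *:%R (g0 c) (g_lin c)).
exists [seq (g q.2, proj_elt e q.1) | q <- s].
rewrite big_map /= -[x](proj_eltK ff) sE.
elim: s {sE} => [|q s IHs]; first by rewrite !big_nil; apply/val_inj;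
  rewrite /= mul0r.
by rewrite !big_cons -IHs; apply/val_inj; rewrite /= mulrDl.
Qed.

Section Step.
(** B plays the role of A / I_j, with projection p; [sec] is only a set-theoretic section. *)
Variables (A B : pzRingType) (p : A -> B) (sec : B -> A).
Hypotheses (pD : {morph p : x y / x + y}) (pM : {morph p : x y / x * y}).
Hypothesis secK : cancel sec p.
Variables (Lam : finType) (e : Lam -> A) (t : seq Lam).
Hypothesis (ee : forall l, e l * e l = e l).
Hypothesis p_ker : forall x, p x = 0 <-> idem_sum e t x.

Let p0 : p 0 = 0. Proof. by apply/p_ker; left. Qed.

Let pN x : p (- x) = - p x.
Proof. by apply: (@addrI _ (p x)); rewrite -pD !subrr. Qed.

Let pee l : p (e l) * p (e l) = p (e l). Proof. by rewrite -pM ee. Qed.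

Lemma idem_ideal_lift l a :
  p a \in idem_ideal (p (e l)) <-> idem_sum e (rcons t l) a.
Proof.
split=> [/asboolP[s]|].
  elim: s a => [|q s IHs] a.
    rewrite big_nil => /p_ker; apply: idem_sum_sub => m mt.
    by rewrite mem_rcons inE mt orbT.
  (* Subtracting a lift of the first summand leaves an element whose image has a shorter
     expression. *)
  rewrite big_cons => pa; rewrite -[a](subrK (sec q.1 * e l * sec q.2)) addrC.
  right; first by rewrite mem_rcons inE eqxx.
  by apply: IHs; rewrite pD pN !pM !secK pa addrC addKr.
elim=> [|b m c z]; first by rewrite p0 rpred0.
rewrite mem_rcons inE => /predU1P[->|mt] _ IH; rewrite pD rpredD //.
  by apply/asboolP; exists [:: (p b, p c)]; rewrite big_seq1 !pM.
rewrite (_ : p _ = 0) ?rpred0 //; apply/p_ker; exact: idem_sum1.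
Qed.

(** The map is a composite: reduce I_{j+1} e_m onto the trace over B, apply the isomorphism g given
    by O_1, then identify each B p(e_l) with A e_l / I_j e_l through h. *)
Lemma O1_presents (X : {set Lam}) l m :
    O1 X (fun l => p (e l)) l -> m \in X ->
  exists n (f : Proj (e m) -> {ffun 'I_n -> quotmod (ideal_part e t l)}),
    presents id (ideal_part e (rcons t l) m) (ideal_part e t m) f.
Proof.
case=> _ /[apply] -[n [g [g' gK g'K]]]; exists n.
pose T := @trace B (Proj (p (e l))) (Proj (p (e m))).
pose f1 (x : Proj (e m)) := proj_elt (p (e m)) (p (submod_val x)).
have f1val x : submod_val (f1 x) = p (submod_val x).
  by rewrite /= -pM (left_idealP _ (ee m)).1 //; apply: (valP x).
have f1_lin a x y : f1 (a *: x + y) = p a *: f1 x + f1 y.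
  by apply/val_inj; rewrite /= pD pM mulrDl -mulrA.
have f1T x : x \in ideal_part e (rcons t l) m <-> f1 x \in T.
  by rewrite ideal_partP mem_trace_proj // f1val idem_ideal_lift.
(* The default 0 is taken only outside I_{j+1} e_m, where a presentation imposes nothing. *)
pose f2 x : submod T := insubd 0 (f1 x).
have f2val x : x \in ideal_part e (rcons t l) m -> submod_val (f2 x) = f1 x.
  by move/f1T => xT; apply: insubdK.
pose h (y : Proj (p (e l))) : quotmod (ideal_part e t l) :=
  \pi_(quotmod _) (proj_elt (e l) (sec (submod_val y))).
have h_eq a b : p a = p b -> \pi_(quotmod (ideal_part e t l)) (proj_elt (e l) a)
    = \pi_(quotmod (ideal_part e t l)) (proj_elt (e l) b).
  move=> pab; apply/eqP; rewrite eq_quotmodE; apply/ideal_partP.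
  rewrite /= -mulrBl; apply: idem_sum_mulr.
  by apply/p_ker; rewrite pD pN pab subrr.
have h_lin b y z : h (p b *: y + z) = b *: h y + h z.
  rewrite /h -quotmod_pi_lin -proj_elt_lin; apply: h_eq.
  by rewrite secK pD pM !secK.
have h_inj y : h y = 0 -> y = 0.
  move/quotmod_pi_eq0/ideal_partP/p_ker; rewrite /= pM secK => y0.
  by rewrite -[y](proj_eltK (pee l)); apply/val_inj.
have h0 : h 0 = 0.
  by apply/quotmod_pi_eq0/ideal_partP/idem_sum_mulr/p_ker; rewrite secK.
exists (fun x => [ffun i => h (g (f2 x) i)]); split.
- move=> a x y xJ yJ; apply/ffunP => i; rewrite !ffunE -h_lin; congr h.
  have -> : f2 (a *: x + y) = p a *: f2 x + f2 y.
    apply/val_inj; rewrite /= f2val ?f1_lin; last by rewrite rpredD ?rpredZ.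
    by rewrite !f2val.
  by rewrite linearP !ffunE.
- move=> d; have h_surj q : exists y, h y = q.
    exists (proj_elt (p (e l)) (p (submod_val (repr q)))).
    rewrite -[q in RHS]reprK -[repr q in RHS](proj_eltK (ee l)).
    by apply: h_eq; rewrite secK /= -pM (left_idealP _ (ee l)).1 //;
      apply: (valP (repr q)).
  have [c cP] := choice (fun i => h_surj (d i)).
  pose u := g' [ffun i => c i];
    pose x := proj_elt (e m) (sec (submod_val (submod_val u))).
  have f1x : f1 x = submod_val u.
    apply/val_inj; rewrite [LHS]f1val /= pM secK.
    by apply/(left_idealP _ (pee m))/(valP (submod_val u)).
  have xJ : x \in ideal_part e (rcons t l) m by apply/f1T; rewrite f1x;
    apply: (valP u).
  have f2x : f2 x = u by apply/val_inj; rewrite /= f2val.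
  by exists x => //; apply/ffunP => i; rewrite ffunE f2x /u g'K ffunE cP.
move=> x xJ; rewrite ideal_partP -p_ker -f1val -f2val //;
  split=> [/ffunP fx|fx].
  have -> : f2 x = 0.
    apply: (can_inj gK); rewrite linear0; apply/ffunP => i.
    by have := fx i; rewrite !ffunE => /h_inj.
  by [].
have -> : f2 x = 0 by apply/val_inj/val_inj.
by rewrite linear0; apply/ffunP => i; rewrite !ffunE h0.
Qed.

End Step.

(** * The whole run and the resulting chains *)

(** The iterated quotient is treated as a single quotient B of A with kernel I_t. The induction
    composes p with the next projection, and [idem_ideal_lift] computes the new kernel. *)
Lemma algorithm_stratifies (A : pzRingType) (Lam : finType) (e : Lam -> A) :
    (forall l, e l * e l = e l) ->
  forall (s : seq Lam) (B : pzRingType) (p : A -> B) (sec : B -> A) t X,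
    {morph p : x y / x + y} -> {morph p : x y / x * y} -> cancel sec p ->
    (forall x, p x = 0 <-> idem_sum e t x) ->
    algorithm s X (fun l => p (e l)) -> stratifies e t X s.
Proof.
move=> ee; elim=> [|l s IHs] B p sec t X pD pM secK p_ker //= [[O1l _] alg_s].
have [lX _] := O1l; split=> // [m mX|];
  first exact: (O1_presents pD pM secK ee p_ker O1l mX).
apply: (IHs _ (fun x => \pi_(quotring (idem_ideal (p (e l)))) (p x)) (fun q =>
  sec (repr q))) alg_s.
- by move=> x y; rewrite pD quotring_piD.
- by move=> x y; rewrite pM -[LHS]quotring_piM.
- by move=> q; rewrite secK reprK.
move=> x; rewrite -(idem_ideal_lift pD pM secK p_ker).
have pi0 : \pi_(quotring (idem_ideal (p (e l)))) 0 = 0.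
  by apply: (@addrI _ (\pi_(quotring (idem_ideal (p (e l)))) 0));
    rewrite -quotring_piD !addr0.
rewrite -pi0; split=> [/eqP|px]; last apply/eqP; by rewrite eq_quotringE subr0.
Qed.

Lemma stratifies_chain (A : pzRingType) (Lam : finType) (e : Lam -> A) s0 l
    (C : lmodType A -> Prop) :
  let K := ideal_part e (take (index l s0) s0) l in
    uniq s0 ->
    (forall m, (index m s0 < index l s0)%N ->
      forall Q, isomorphic Q (quotmod (ideal_part e (take (index m s0) s0) m))
        -> C Q) ->
  forall s t X, s0 = t ++ s -> stratifies e t X s -> l \in X -> l \in s ->
    chain C (@restrict_submod _ _ K (ideal_part e t l)) (@restrict_submod _ _
      K K).
Proof.
move=> K us0 CP; elim=> [|m s IHs] t X //= s0E [mX HX strat_s] lX ls.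
have mt : m \notin t.
  by move: us0; rewrite s0E cat_uniq /= => /and3P[_ /norP[]].
have im : index m s0 = size t.
  by rewrite s0E index_cat (negPf mt) /= eqxx addn0.
have [lm|lm] := eqVneq l m.
  (* On reaching l, the list t is exactly the part of [s0] before l, so the chain has arrived at
     K. *)
  rewrite (_ : K = ideal_part e t l); first exact: rt_refl.
  by rewrite /K lm im s0E take_size_cat.
have ls' : l \in s by move: ls; rewrite inE (negPf lm).
have lt : l \notin t.
  move: us0; rewrite s0E cat_uniq => /and3P[_ /hasPn/(_ l) + _]; apply.
  by rewrite inE ls' orbT.
have [n [f fP]] := HX l lX.
have lt_ml : (index m s0 < index l s0)%N.
  by rewrite im s0E index_cat (negPf lt) /= eq_sym (negPf lm) -[ltnLHS]addn0
    ltn_add2l.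
have sub_t : {subset t <= rcons t m} by move=> i it;
  rewrite mem_rcons inE it orbT.
have sub_K : {subset rcons t m <= take (index l s0) s0}.
  move=> i it; rewrite in_take_leq ?index_size //; apply: leq_trans lt_ml.
  by rewrite im s0E -cat_rcons index_cat it -[(size t).+1](size_rcons t m)
    index_mem.
pose J := ideal_part e (rcons t m) l.
apply: (rt_trans _ _ _ (@restrict_submod _ _ K J : submodClosed (submod K))).
  apply: (chain_ffun _ _ (presents_restrict _ fP)) => [Q isoQ|x|x].
  - by apply: (CP m) => //; rewrite im s0E take_size_cat.
  - by move/ideal_partP => xJ; apply/ideal_partP; apply: idem_sum_sub xJ.
  - by move/ideal_partP => xJ; apply/ideal_partP; apply: idem_sum_sub xJ.
apply: (IHs _ (X :\ m)) => //; first by rewrite s0E cat_rcons.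
by rewrite !inE lm.
Qed.

Lemma idem_sum_nil (A : pzRingType) (Lam : finType) (e : Lam -> A) x :
  x = 0 <-> idem_sum e [::] x.
Proof. by split=> [->|]; [left | elim]. Qed.

(** * The kernel of P_l -> Delta_l *)

Section StandardKernel.
Variables (k : fieldType) (A : falgType k) (Lam : finType) (e : Lam -> A).
Hypothesis e_prim : forall l, primitive_idempotent (e l).

(** Each e_m with m in t kills P_l / I_t e_l, which excludes S_m. Conversely, if P_l / N has no
    factor S_m for m in t, all e_m b e_l lie in N, and they generate I_t e_l. *)
Lemma ideal_part_standard_kernel (r : rel Lam) t l :
  (forall m, r m l = (m \notin t)) -> standard_kernel r (ideal_part e t l).
Proof.
move=> rE; have ee m : e m * e m = e m by have [] := e_prim m.
split=> [m mfac|N Nbelow x].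
  rewrite rE; apply/negP => mt.
  have [|y yE y0] := composition_factor_Simp (ee m) (@finite_length_proj _ _
    _) _ mfac.
    by have [] := e_prim m.
  case/eqP: y0; rewrite -yE -[y]reprK; apply: etrans (quotmod_scale_pi _ _ _) _.
  apply/quotmod_pi_eq0/ideal_partP; rewrite /= -[e m]mul1r; exact: idem_sum1.
move/ideal_partP => xt; rewrite -[x](proj_eltK (ee l)).
elim: xt => [|a m b z mt _ IH].
  by rewrite (_ : proj_elt _ _ = 0) ?rpred0 //; apply/val_inj; rewrite /= mul0r.
rewrite -mulrA proj_elt_lin rpredD ?rpredZ //; apply/negPn/negP => yN.
have := Nbelow m; rewrite rE mt; move=> /(_ _)/notF; apply.
apply: (@Simp_composition_factor _ _ _ (\pi_(quotmod N) (proj_elt (e l) (e m *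
  b)))).
- exact: ee.
- exact/finite_length_quot/finite_length_proj.
- exact: maximal_sub_radical.
- apply: etrans (quotmod_scale_pi _ _ _) _; congr (\pi_(quotmod N) _).
  by apply/val_inj; rewrite /= -[RHS]mulrA -[in RHS](ee m) -!mulrA.
by apply/eqP => /quotmod_pi_eq0; apply/negP.
Qed.

End StandardKernel.

Theorem proposition4p1 (k : closedFieldType) (A : falgType k) (Lam : finType)
    (e : Lam -> A)
    (e_prim : forall l, primitive_idempotent (e l))
    (e_orth : forall l m, l != m -> e l * e m = 0)
    (e_sum : \sum_l e l = 1)
    (A_basic : basic_idempotents e) :
  forall r : rel Lam, algorithm_orders e r -> standardly_stratified e r.
Proof.
move=> r [s [alg_s size_s rE]].
have ee l : e l * e l = e l by have [] := e_prim l.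
have strat_s : stratifies e [::] setT s.
  apply: (algorithm_stratifies ee (B := A) (p := id) (sec := id)) alg_s => //.
  exact: idem_sum_nil.
have [us _] := stratifies_uniq strat_s.
(* A duplicate-free list of length |Lam| exhausts Lam. *)
have sT l : l \in s.
  have /(uniq_min_size us)[|_ ->] : {subset s <= enum Lam}.
  - by move=> m; rewrite mem_enum.
  - by rewrite -cardE size_s.
  - by rewrite mem_enum.
pose K l := ideal_part e (take (index l s) s) l.
have Kstd l : standard_kernel r (K l).
  apply: ideal_part_standard_kernel => // m; rewrite rE /chain_order.
  by rewrite in_take_leq ?index_size // leqNgt.
exists K; split=> // l.
pose C Q := exists m, [/\ r l m, m != l & isomorphic Q (quotmod (K m))].
have CP m : (index m s < index l s)%N ->
    forall Q, isomorphic Q (quotmod (K m)) -> C Q.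
  move=> lt_ml Q isoQ; exists m; split=> //.
    by rewrite rE /chain_order ltnW.
  by apply: contraTneq lt_ml => ->; rewrite ltnn.
have ch := stratifies_chain us CP (erefl : s = [::] ++ s) strat_s (in_setT l)
  (sT l).
(* The chain starts at I_0 e_l = 0 and ends at K l inside itself. *)
have [x /ideal_partP/idem_sum_nil x0|x|n [F [Ffil FC _ _]]] :=
  chain_filtration ch.
- exact/val_inj/val_inj.
- exact: valP x.
by exists n, F.
Qed.
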